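(* Every uniformly convex real Banach space $Y$ has the approximate hyperplane sum property for $\ell_\infty^4$ (AHSp-$\ell_\infty^4$). Moreover, if $\delta_Y$ is the modulus of convexity of $Y$, then $Y$ has the AHSp-$\ell_\infty^4$ with the function $\gamma(\varepsilon)=\min\bigl\{\frac{\delta_Y(\varepsilon)}{2},\frac{\varepsilon}{6}\bigr\}$.
   Context: All spaces are real. $B_Y$, $S_Y$, $Y^*$ denote the closed unit ball, unit sphere and topological dual of $Y$. $Y$ is uniformly convex if for every $\varepsilon>0$ there is $0<\delta<1$ such that $u,v\in B_Y$ and $\frac{\|u+v\|}{2}>1-\delta$ imply $\|u-v\|<\varepsilon$. Its modulus of convexity is $\delta_Y(\varepsilon)=\inf\bigl\{1-\frac{\|u+v\|}{2}:u,v\in B_Y,\ \|u-v\|\ge\varepsilon\bigr\}$. $M_Y^4=\{(y_i)_{i\le 4}\in (B_Y)^4: y_{i_1}-y_{i_2}+y_{i_3}\in B_Y \text{ for all } 1\le i_1<i_2<i_3\le 4\}$. $Y$ has the AHSp-$\ell_\infty^4$ with the function $\gamma:(0,1)\to\mathbb{R}$, where $0<\gamma(\varepsilon)<\varepsilon$, if for every $0<\varepsilon<1$ and every $(y_i)_{i\le 4}\in M_Y^4$: whenever there exist a nonempty $A\subset\{1,2,3,4\}$ and $y^*\in S_{Y^*}$ with $y^*(y_i)>1-\gamma(\varepsilon)$ for each $i\in A$, there exists $(z_i)_{i\le 4}\in M_Y^4$ with $\|z_i-y_i\|<\varepsilon$ for every $i\le 4$ and $\|\sum_{i\in A}z_i\|=|A|$.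 $Y$ has the AHSp-$\ell_\infty^4$ if it has it with some such $\gamma$. *)

(* Defs.v *)
From HB Require Import structures.
From mathcomp Require Import all_boot all_order all_algebra.
From mathcomp Require Import all_classical all_reals all_analysis.
Set Implicit Arguments.
Unset Strict Implicit.
Unset Printing Implicit Defensive.
Import Order.TTheory GRing.Theory Num.Theory.
Import numFieldNormedType.Exports.
Local Open Scope classical_set_scope.
Local Open Scope ring_scope.

Definition unit_ball (R : realType) (Y : normedModType R) : set Y := [set y | `|y| <= 1].
Arguments unit_ball {R} Y _.

(* The set of values is nonempty, and bounded when f is continuous, so the
   real-valued supremum is the usual operator norm there. *)
Definition dual_norm (R : realType) (Y : normedModType R) (f : {linear Y -> R^o}) : R :=
  sup [set `|f y| | y in unit_ball Y].

Definition dual_sphere (R : realType) (Y : normedModType R) : set {linear Y -> R^o} :=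
  [set f : {linear Y -> R^o} | continuous f /\ dual_norm f = 1].
Arguments dual_sphere {R} Y _.

Definition uniformly_convex (R : realType) (Y : normedModType R) : Prop :=
  forall eps : R, 0 < eps ->
    exists delta : R, 0 < delta < 1 /\
      forall u v : Y, unit_ball Y u -> unit_ball Y v ->
        `|u + v| / 2 > 1 - delta -> `|u - v| < eps.

(* Extended-real-valued because the infimum is over the empty set, hence +oo,
   when eps > 2, or when eps > 0 and Y = {0}. *)
Definition modulus_of_convexity (R : realType) (Y : normedModType R) (eps : R) : \bar R :=
  ereal_inf [set (1 - `|uv.1 + uv.2| / 2)%:E | uv in
    [set uv : Y * Y | [/\ unit_ball Y uv.1, unit_ball Y uv.2
                        & `|uv.1 - uv.2| >= eps]]].

Definition M4 (R : realType) (Y : normedModType R) : set ('I_4 -> Y) :=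
  [set y | (forall i, unit_ball Y (y i)) /\
           (forall i1 i2 i3 : 'I_4, (i1 < i2)%N -> (i2 < i3)%N ->
              unit_ball Y (y i1 - y i2 + y i3))].
Arguments M4 {R} Y _.

(* Only the values of gamma on the open interval (0, 1) matter. *)
Definition AHSp_linfty4_with (R : realType) (Y : normedModType R) (gamma : R -> R) : Prop :=
  (forall eps : R, 0 < eps < 1 -> 0 < gamma eps < eps) /\
  (forall eps : R, 0 < eps < 1 ->
     forall y : 'I_4 -> Y, M4 Y y ->
     forall (A : {set 'I_4}) (f : {linear Y -> R^o}),
       A != finset.set0 -> dual_sphere Y f ->
       (forall i, i \in A -> (f (y i) : R) > 1 - gamma eps) ->
       exists z : 'I_4 -> Y,
         [/\ M4 Y z,
             forall i, `|z i - y i| < eps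
           & `|\sum_(i in A) z i| = #|A|%:R]).

Definition AHSp_linfty4 (R : realType) (Y : normedModType R) : Prop :=
  exists gamma : R -> R, AHSp_linfty4_with Y gamma.

(* The minimum is always finite: the modulus of convexity is nonnegative and
   eps / 6 is real. *)
Definition gamma_modulus (R : realType) (Y : normedModType R) (eps : R) : R :=
  fine (mine (modulus_of_convexity Y eps * (2^-1 : R)%:E) (eps / 6 : R)%:E)%E.

(* Main.v *)
Require Import Defs.
From mathcomp Require Import all_boot all_order all_algebra.
From mathcomp Require Import all_classical all_reals all_analysis.
From mathcomp Require Import zify lra.

(** Let p and q be the least and greatest elements of A, let r = |y_p| and
    e = y_p / r, so that 1 - r < gamma.  For p < i < q, the point
    y_p - y_i + y_q lies in the ball, hence y^*(y_i) > 1 - 2 gamma, and the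
    modulus of convexity puts every y_i with p <= i <= q within epsilon of e.
    Replacing these y_i by y_p keeps the family in M^4; the resulting family Y
    is then moved slightly by z_i = r Y_i + (1 - r^2) c_i e with
    c_i = 1 - dist(i, [p, q]) / 2.  This gives z_i = e on [p, q], while all
    the other coefficients c_i, and all the c_i - c_j + c_l with i < j < l not
    all in [p, q], have absolute value at most 1/2, which compensates the
    factor 1 - r^2 = (1 + r)(1 - r) <= 2 (1 - r). *)

Set Implicit Arguments.
Unset Strict Implicit.
Unset Printing Implicit Defensive.
Import Order.TTheory GRing.Theory Num.Theory.
Import numFieldNormedType.Exports.
Local Open Scope classical_set_scope.
Local Open Scope ring_scope.

Lemma dual_sphere_le (R : realType) (Y : normedModType R)
    (f : {linear Y -> R^o}) (v : Y) : dual_sphere Y f -> (f v : R) <= `|v|.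
Proof.
move=> [_ f1].
(* [sup] takes the default value 0 on a set without supremum, so the value 1 of the dual norm rules
   that out. *)
have hs : has_sup [set (`|f y| : R) | y in unit_ball Y].
  apply: contrapT => /sup_out h; move: f1; rewrite /dual_norm h.
  by move=> /esym/eqP; rewrite oner_eq0.
have ball_le u : unit_ball Y u -> (f u : R) <= 1.
  move=> u1; apply: le_trans (ler_norm (f u : R)) _; rewrite -f1.
  by apply: (ubP _ _).1; [exact: sup_upper_bound|exists u].
have [->|v0] := eqVneq v 0; first by rewrite linear0 normr0.
have nv : 0 < `|v| by rewrite normr_gt0.
have := ball_le (`|v|^-1 *: v).
rewrite /unit_ball /= normrZ normfV normr_id mulVf ?gt_eqF // => /(_ (lexx _)).
by rewrite linearZ /= => h; rewrite -(ler_pM2l (x := `|v|^-1)) ?invr_gt0 // mulVf ?gt_eqF.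
Qed.

Lemma modulus_of_convexity_gt0 (R : realType) (Y : normedModType R) (eps : R) :
  uniformly_convex Y -> 0 < eps -> (0 < modulus_of_convexity Y eps)%E.
Proof.
move=> hY /hY [d [/andP[d0 _] hd]].
apply: (@lt_le_trans _ _ d%:E); first by rewrite lte_fin.
apply: le_ereal_inf_tmp => _ [[u v] /= [u1 v1 uv]] <-; rewrite lee_fin lerBrDr -lerBrDl.
by rewrite leNgt; apply/negP => /(hd _ _ u1 v1); rewrite ltNge uv.
Qed.

Lemma modulus_of_convexity_close (R : realType) (Y : normedModType R)
    (eps s : R) (u v : Y) :
  (s%:E <= modulus_of_convexity Y eps)%E -> unit_ball Y u -> unit_ball Y v ->
  1 - s < `|u + v| / 2 -> `|u - v| < eps.
Proof.
move=> hs u1 v1 huv; rewrite ltNge; apply/negP => uv.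
have : (s%:E <= (1 - `|u + v| / 2)%:E)%E.
  by apply: le_trans hs _; apply: ereal_inf_lbound; exists (u, v).
by rewrite lee_fin; lra.
Qed.

(** These real bounds spare the main proof the infinite case: when the modulus is [+oo], the minimum
    is [eps / 6]. *)
Lemma gamma_modulusP (R : realType) (Y : normedModType R) (eps : R) :
  uniformly_convex Y -> 0 < eps ->
  [/\ 0 < gamma_modulus Y eps, gamma_modulus Y eps <= eps / 6
    & ((2 * gamma_modulus Y eps)%:E <= modulus_of_convexity Y eps)%E].
Proof.
move=> hY e0; have := modulus_of_convexity_gt0 hY e0.
rewrite /gamma_modulus; case: (modulus_of_convexity Y eps) => [d||] //.
- rewrite lte_fin => d0; rewrite -EFinM -EFin_min /= lee_fin.
  split; first by rewrite lt_min; apply/andP; split; lra.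
    by rewrite ge_min lexx orbT.
  have : Num.min (d * 2^-1) (eps / 6) <= d / 2 by rewrite ge_min lexx.
  lra.
- move=> _; rewrite gt0_mulye ?lte_fin ?invr_gt0 // minye /=.
  by split; rewrite ?leey //; lra.
Qed.

Lemma norm_perturb_le1 (R : realType) (Y : normedModType R) (r c : R) (u e : Y) :
  0 <= r <= 1 -> unit_ball Y u -> unit_ball Y e -> `|c| <= 1 / 2 ->
  unit_ball Y (r *: u + ((1 - r ^+ 2) * c) *: e).
Proof.
rewrite /unit_ball /= => /andP[r0 r1] u1 e1 c1.
apply: le_trans (ler_normD _ _) _; rewrite !normrZ.
rewrite (ger0_norm r0) ger0_norm; last by nra.
have : r * `|u| <= r by nra.
have : `|c| * `|e| <= 1 / 2 by have := normr_ge0 c; have := normr_ge0 e; nra.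
rewrite -mulrA; move: (`|c| * `|e|) (r * `|u|) => a b a1 br.
have : 0 <= 1 - r ^+ 2 <= 2 * (1 - r) by apply/andP; split; nra.
by move=> /andP[r20 r2]; nra.
Qed.

Section IntervalGap.
Variables p q : 'I_4.

(* Distance from i to the interval [p, q], by truncated subtraction. *)
Definition gap (i : 'I_4) : nat := ((p - i) + (i - q))%N.

Lemma gap_eq0 (i : 'I_4) : (gap i == 0%N) = (p <= i <= q)%N.
Proof. by rewrite addn_eq0 !subn_eq0. Qed.

Definition gap_coef (R : realType) (i : 'I_4) : R := 1 - (gap i)%:R / 2.

Definition collapse (T : Type) (y : 'I_4 -> T) (i : 'I_4) : T :=
  if gap i == 0%N then y p else y i.

(** In a triple i < j < l, two neighbours in [p, q] cancel and leave one point of the ball; i and l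
    cannot both lie in [p, q] without j. If just one index lies there, putting p in its place keeps
    the order. *)
Lemma collapse_M4 (R : realType) (Y : normedModType R) (y : 'I_4 -> Y) :
  (p <= q)%N -> M4 Y y -> M4 Y (collapse y).
Proof.
move=> pq [y1 y3]; split=> [i|i j l ij jl]; rewrite /collapse; first by case: ifP.
case: (eqVneq (gap i) 0%N) => gi; case: (eqVneq (gap j) 0%N) => gj;
  case: (eqVneq (gap l) 0%N) => gl; rewrite ?subrr ?add0r ?subrK //.
- by move: gi gj gl; rewrite /gap; lia.
- by apply: y3 => //; move: gi gj gl; rewrite /gap; lia.
- by apply: y3 => //; move: gi gj gl; rewrite /gap; lia.
- by apply: y3 => //; move: gi gj gl; rewrite /gap; lia.
- exact: y3.
Qed.

Lemma gap_coef_le (R : realType) (i : 'I_4) :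
  gap i != 0%N -> `|gap_coef R i| <= 1 / 2.
Proof.
(* Among four indices the gap is at most 3, and 1 - 3/2 = -1/2 is just allowed. *)
move=> gi; have : (1 <= gap i <= 3)%N.
  by rewrite lt0n gi /gap; case: i p q {gi} => [i hi] [a ha] [b hb] /=; lia.
rewrite -!(ler_nat R) => /andP[g1 g3]; rewrite /gap_coef ler_norml.
by apply/andP; split; lra.
Qed.

(** The combination is 1 - ([gap i] - [gap j] + [gap l]) / 2, so the bound amounts to an integer
    between 1 and 3. It is at least 1 because the gap strictly decreases up to p and strictly
    increases from q on. *)
Lemma gap_coef_triple_le (R : realType) (i j l : 'I_4) :
  (p <= q)%N -> (i < j)%N -> (j < l)%N ->
  ~~ [&& gap i == 0%N, gap j == 0%N & gap l == 0%N] ->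
  `|gap_coef R i - gap_coef R j + gap_coef R l| <= 1 / 2.
Proof.
move=> pq ij jl nz.
have : (gap j + 1 <= gap i + gap l <= gap j + 3)%N.
  move: nz pq ij jl; rewrite /gap.
  by case: i j l p q => [i hi] [j hj] [l hl] [a ha] [b hb] /= nz pq ij jl; lia.
rewrite /gap_coef; move: (gap i) (gap j) (gap l) => gi gj gl.
rewrite -!(ler_nat R) !natrD ler_norml => /andP[g1 g3].
by apply/andP; split; lra.
Qed.

End IntervalGap.

Lemma scale_unit_direction (R : realType) (Y : normedModType R) (v : Y) :
  `|v| != 0 -> `|v| *: (`|v|^-1 *: v) = v.
Proof. by move=> v0; rewrite scalerA mulfV // scale1r. Qed.

(* On [p, q] this is constantly r^-1 *: y p, since r *: y p = r ^+ 2 *: (r^-1 *: y p). *)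
Definition flatten_family (R : realType) (Y : normedModType R) (p q : 'I_4)
    (y : 'I_4 -> Y) (i : 'I_4) : Y :=
  let r := `|y p| in
  r *: collapse p q y i + ((1 - r ^+ 2) * gap_coef p q R i) *: (r^-1 *: y p).

Section FlattenFamily.
Variables (R : realType) (Y : normedModType R) (p q : 'I_4) (y : 'I_4 -> Y).
Hypotheses (pq : (p <= q)%N) (My : M4 Y y) (yp0 : 0 < `|y p|).

Let e := `|y p|^-1 *: y p.
Let z := flatten_family p q y.

Lemma norm_unit_direction : `|e| = 1.
Proof. by rewrite normrZ normfV normr_id mulVf ?gt_eqF. Qed.

Lemma flatten_family_in (i : 'I_4) : gap p q i = 0%N -> z i = e.
Proof.
move=> gi; rewrite /z /flatten_family /collapse /gap_coef gi eqxx mul0r subr0 mulr1 -/e.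
rewrite -{2}(@scale_unit_direction _ _ (y p)) ?gt_eqF // -/e scalerA -scalerDl.
by rewrite -expr2 addrC subrK scale1r.
Qed.

Lemma flatten_family_M4 : M4 Y z.
Proof.
have [c1 c3] := collapse_M4 pq My.
have e1 : unit_ball Y e by rewrite /unit_ball /= norm_unit_direction.
have r01 : 0 <= `|y p| <= 1 by rewrite normr_ge0; exact: My.1.
split=> [i|i j l ij jl].
  have [gi|gi] := eqVneq (gap p q i) 0%N; first by rewrite flatten_family_in.
  exact: norm_perturb_le1 (gap_coef_le _ gi).
have [/and3P[/eqP gi /eqP gj /eqP gl]|nz] :=
    boolP [&& gap p q i == 0%N, gap p q j == 0%N & gap p q l == 0%N].
  by rewrite !flatten_family_in // subrr add0r.
(* Alternating sums of the new family keep the perturbed form, with the alternating sum of the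
   coefficients. *)
have -> : z i - z j + z l =
    `|y p| *: (collapse p q y i - collapse p q y j + collapse p q y l) +
    ((1 - `|y p| ^+ 2) * (gap_coef p q R i - gap_coef p q R j + gap_coef p q R l)) *: e.
  rewrite /z /flatten_family -/e.
  move: (gap_coef _ _ _ i) (gap_coef _ _ _ j) (gap_coef _ _ _ l) => a b c.
  rewrite mulrDr mulrBr scalerDl scalerBl scalerDr scalerBr.
  by rewrite opprD [in RHS]addrACA; congr (_ + _); rewrite addrACA.
by apply: norm_perturb_le1 => //; [exact: c3|exact: gap_coef_triple_le].
Qed.

(** Here z_i - y_i = (1 - r^2) c_i e - (1 - r) y_i, and each term has norm at most 1 - r. *)
Lemma flatten_family_out (i : 'I_4) :
  gap p q i != 0%N -> `|z i - y i| <= 2 * (1 - `|y p|).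
Proof.
move=> gi; rewrite /z /flatten_family /collapse (negbTE gi) -/e.
have r1 : `|y p| <= 1 by exact: My.1.
have yi1 : `|y i| <= 1 by exact: My.1.
have c1 := gap_coef_le R gi.
set c := gap_coef _ _ _ _ in c1 *.
have -> : `|y p| *: y i + ((1 - `|y p| ^+ 2) * c) *: e - y i =
   ((1 - `|y p| ^+ 2) * c) *: e - (1 - `|y p|) *: y i.
  by rewrite scalerBl scale1r opprB addrCA addrA.
apply: le_trans (ler_normB _ _) _; rewrite normrZ norm_unit_direction mulr1 normrM normrZ.
have r2 : 0 <= 1 - `|y p| ^+ 2 <= 2 * (1 - `|y p|) 
  by move: `|y p| yp0 r1 => r r0 r1; apply/andP; split; nra.
rewrite (ger0_norm (proj1 (andP r2))) (@ger0_norm _ (1 - `|y p|)); last by lra.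
by case/andP: r2 => r20 r2; nra.
Qed.

End FlattenFamily.

Lemma ahsp_gamma_modulus (R : realType) (Y : normedModType R) :
  uniformly_convex Y -> AHSp_linfty4_with Y (gamma_modulus Y).
Proof.
move=> hY; split=> [eps /andP[e0 _]|eps /andP[e0 e1] y My A f A0 hf hA].
  by have [g0 g6 _] := gamma_modulusP hY e0; apply/andP; split=> //; lra.
have [g0 g6 gm] := gamma_modulusP hY e0.
set g := gamma_modulus Y eps in hA g0 g6 gm.
have /finset.set0Pn [a aA] := A0.
case: (@arg_minnP _ a (mem A) (@nat_of_ord 4) aA) => p pA minp.
case: (@arg_maxnP _ a (mem A) (@nat_of_ord 4) aA) => q qA maxq.
have pq : (p <= q)%N by exact: minp.
have fle v : (f v : R) <= `|v| by exact: dual_sphere_le.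
have fp := hA p pA; have rp := fle (y p); have r1 : `|y p| <= 1 by exact: My.1.
have r0 : 0 < `|y p| by lra.
have gapA i : i \in A -> gap p q i = 0%N.
  by move=> iA; apply/eqP; rewrite gap_eq0 (minp i iA); exact: maxq.
set e := `|y p|^-1 *: y p.
(* Dividing the positive value f(y_p) by r <= 1 does not decrease it. *)
have fe : 1 - g < (f e : R).
  have -> : (f e : R) = `|y p|^-1 * (f (y p) : R) by rewrite linearZ.
  apply: (lt_le_trans fp); rewrite ler_peMl //; last by rewrite invf_ge1.
  by lra.
have f_in i : gap p q i = 0%N -> 1 - 2 * g < (f (y i) : R).
  move=> /eqP; rewrite gap_eq0 => /andP[pi qi].
  have [iA|iA] := boolP (i \in A); first by have := hA i iA; lra.
  (* Both p and q belong to A and i does not, so the inequalities are strict. *)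
  have {}pi : (p < i)%N by rewrite ltn_neqAle pi andbT; apply: contraNneq iA => /val_inj <-.
  have {}qi : (i < q)%N by rewrite ltn_neqAle qi andbT; apply: contraNneq iA => /val_inj ->.
  have := fle (y p - y i + y q); have /= := My.2 _ _ _ pi qi.
  rewrite /unit_ball /= linearD linearB /=.
  have := hA q qA; rewrite -/g => h1 h2 h3.
  have {}h3 : (f (y p) : R) - f (y i) + f (y q) <= `|y p - y i + y q| := h3.
  lra.
exists (flatten_family p q y); split; first exact: flatten_family_M4.
- move=> i; have [gi|gi] := eqVneq (gap p q i) 0%N.
    rewrite flatten_family_in //; apply: modulus_of_convexity_close gm _ _ _.
    + by rewrite /unit_ball /= norm_unit_direction.
    + exact: My.1.
    (* f(e) + f(y_i) > 2 - 3g, so half the norm of e + y_i exceeds 1 - 2g. *)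
    have := fle (e + y i); rewrite linearD /= => h.
    have {}h : (f e : R) + f (y i) <= `|e + y i| := h.
    by have := f_in i gi; rewrite -/e; lra.
  (* 2(1 - r) < 2g <= [eps / 3]. *)
  by apply: le_lt_trans (flatten_family_out My r0 gi) _; lra.
- rewrite (eq_bigr (fun=> e)) => [|i iA]; last by rewrite flatten_family_in ?gapA.
  by rewrite sumr_const normrMn norm_unit_direction.
Qed.

Theorem proposition4p3 (R : realType) (Y : completeNormedModType R)
    (hY : uniformly_convex Y) :
  AHSp_linfty4 Y /\ AHSp_linfty4_with Y (gamma_modulus Y).
Proof.
have h := ahsp_gamma_modulus hY.
by split=> //; exists (gamma_modulus Y).
Qed.
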